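(* Let $m\in\mathbb{N}$, $q\in(0,\infty]$, let $I$ be a non-empty set, and let $E_1,\dots,E_m$ be infinite-dimensional Banach spaces over $\mathbb{K}$ with $\dim E_i<\mathrm{card}\,I$ for $i=1,\dots,m$. Let $\mathbf{r},\mathbf{s},\mathbf{t},\mathbf{u}\in[1,+\infty)^m$ and let $\Lambda\subset\Gamma\subset\mathbb{N}^m$ be (non-empty) sets of indexes. Then the set $$\Pi_{(\mathbf{r},\mathbf{s})}^{\Lambda}(E_1,\ldots,E_m;\ell_q(I))\setminus\Pi_{(\mathbf{t},\mathbf{u})}^{\Gamma}(E_1,\ldots,E_m;\ell_q(I))$$ is either empty or, for every cardinal $\alpha<\mathrm{card}\,I$, $(\alpha,\mathrm{card}\,I)$-lineable (as a subset of the vector space $\Pi_{(\mathbf{r},\mathbf{s})}^{\Lambda}(E_1,\ldots,E_m;\ell_q(I))$).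
   Context: $\mathbb{K}$ is $\mathbb{R}$ or $\mathbb{C}$; $\mathbb{N}=\{1,2,3,\dots\}$; $\dim$ denotes the algebraic (Hamel) dimension. $E'$ is the topological dual of $E$ and $B_{E'}$ its closed unit ball. For $q\in(0,\infty)$, $\ell_q(I)$ is the space of functions $f:I\to\mathbb{K}$ with $\sum_{i\in I}|f(i)|^q:=\sup\{\sum_{i\in F}|f(i)|^q: F\subset I\text{ finite}\}<\infty$, a quasi-Banach space under $\|f\|_q=(\sum_{i\in I}|f(i)|^q)^{1/q}$; $\ell_\infty(I)$ is the space of bounded functions $f:I\to\mathbb{K}$ with the sup norm. Mixed norms: for a quasi-Banach space $F$, $\mathbf{r}=(r_1,\dots,r_m)\in[1,\infty)^m$ and $(x_{\mathbf{i}})_{\mathbf{i}\in\mathbb{N}^m}\subset F$, with $\mathbf{i}=(i_1,\dots,i_m)$, $$\|(x_{\mathbf{i}})_{\mathbf{i}\in\mathbb{N}^m}\|_{\ell_{\mathbf{r}}(F)}=\Big(\sum_{i_1=1}^\infty\Big(\cdots\Big(\sum_{i_m=1}^\infty\|x_{\mathbf{i}}\|_F^{r_m}\Big)^{\frac{r_{m-1}}{r_m}}\cdots\Big)^{\frac{r_1}{r_2}}\Big)^{\frac1{r_1}},$$ and for non-empty $\Lambda\subset\mathbb{N}^m$, $\|(x_{\mathbf{i}})_{\mathbf{i}\in\Lambda}\|_{\ell_{\mathbf{r}}(F)}$ is the norm of the multi-matrix that equals $x_{\mathbf{i}}$ on $\Lambda$ and $0$ off $\Lambda$. $\Lambda$-summing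 operators: an $m$-linear operator $T:E_1\times\cdots\times E_m\to F$ is $\Lambda$-$(\mathbf{r};\mathbf{s})$-summing if there is $C>0$ such that $$\|(Tx_{\mathbf{i}})_{\mathbf{i}\in\Lambda}\|_{\ell_{\mathbf{r}}(F)}\le C\prod_{k=1}^m\sup_{\phi_k\in B_{E_k'}}\Big(\sum_{i=1}^N|\phi_k(x_i^{(k)})|^{s_k}\Big)^{1/s_k}$$ for all $N\in\mathbb{N}$ and $x_i^{(k)}\in E_k$, $k=1,\dots,m$, $i=1,\dots,N$, where $Tx_{\mathbf{i}}:=T(x_{i_1}^{(1)},\dots,x_{i_m}^{(m)})$ (with $x_i^{(k)}=0$ for $i>N$). $\Pi^{\Lambda}_{(\mathbf{r},\mathbf{s})}(E_1,\dots,E_m;F)$ is the vector space of all such operators. Lineability: a subset $A$ of a vector space $V$ is $\alpha$-lineable if $A\cup\{0\}$ contains an $\alpha$-dimensional linear subspace of $V$. For cardinals $\alpha<\beta\le\dim V$, $A\subset V$ is $(\alpha,\beta)$-lineable if it is $\alpha$-lineable and for every subspace $W_\alpha\subset V$ with $W_\alpha\subset A\cup\{0\}$ and $\dim W_\alpha=\alpha$ there is a subspace $W_\beta\subset V$ with $\dim W_\beta=\beta$ and $W_\alpha\subset W_\beta\subset A\cup\{0\}$. *)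

(* Defs.v *)
From HB Require Import structures.
From mathcomp Require Import all_boot all_order all_algebra finmap.
From mathcomp Require Import complex.
From mathcomp Require Import all_classical all_reals all_analysis.

Set Implicit Arguments.
Unset Strict Implicit.
Unset Printing Implicit Defensive.

Import Order.TTheory GRing.Theory Num.Theory.
Import numFieldNormedType.Exports.

Local Open Scope classical_set_scope.
Local Open Scope card_scope.
Local Open Scope ring_scope.

Definition card_lt (T U : Type) (A : set T) (B : set U) : Prop :=
  (A #<= B) /\ ~ (B #<= A).

Section Lineability.
Variables (K : fieldType) (L : lmodType K).
Implicit Types (A B V W : set L).

Definition lin_span B : set L :=
  [set v | exists (X : {fset L}) (c : L -> K),
     [set` X] `<=` B /\ v = \sum_(u <- X) c u *: u].

Definition lin_indep B : Prop :=
  forall (X : {fset L}) (c : L -> K), [set` X] `<=` B ->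
  \sum_(u <- X) c u *: u = 0 -> {in X, forall u, c u = 0}.

Definition hamel_basis W B : Prop := lin_indep B /\ lin_span B = W.

(* Cardinals have no type of their own: a cardinal is given by any set [S] of
   that cardinality. *)
Definition dim_eq W (T : Type) (S : set T) : Prop :=
  exists2 B, hamel_basis W B & B #= S.
Definition dim_ge W (T : Type) (S : set T) : Prop :=
  exists2 B, hamel_basis W B & S #<= B.
Definition dim_lt W (T : Type) (S : set T) : Prop :=
  exists2 B, hamel_basis W B & card_lt B S.
Definition infinite_dim W : Prop :=
  ~ exists2 B, hamel_basis W B & finite_set B.

Definition subspace W : Prop := submod_closed [in W].

(* The ambient vector space is itself a linear subspace [V] of [L]. *)
Definition lineable V A (T : Type) (S : set T) : Prop :=
  exists W, [/\ subspace W, W `<=` V, W `<=` A `|` [set 0] & dim_eq W S].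

Definition lineable2 V A (T U : Type) (S : set T) (S' : set U) : Prop :=
  [/\ card_lt S S', dim_ge V S', lineable V A S &
    forall W, subspace W -> W `<=` V -> W `<=` A `|` [set 0] -> dim_eq W S ->
    exists W', [/\ subspace W', W' `<=` V, dim_eq W' S', W `<=` W' &
                   W' `<=` A `|` [set 0]]].

End Lineability.

Variant scalars := RealScalars | ComplexScalars.

Definition scalar_field (R : realType) (k : scalars) : numFieldType :=
  match k with RealScalars => R | ComplexScalars => R[i]%C end.

Section Norms.
Variables (R : realType) (k : scalars).
Local Notation K := (scalar_field R k).

Definition real_part : K -> R :=
  match k return scalar_field R k -> R with
  | RealScalars => id
  | ComplexScalars => @complex.Re R
  end.

(* Norms of [normedModType K] are [K]-valued; [rnorm] is the real number. *)
Definition rnorm (V : normedZmodType K) (v : V) : R := real_part `|v|.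

Lemma real_partD (x y : K) : real_part (x + y) = real_part x + real_part y.
Proof. by rewrite /real_part; case: k x y => //= -[a b] [c d]. Qed.

Lemma ler_real_part (x y : K) : x <= y -> real_part x <= real_part y.
Proof.
rewrite /real_part; case: k x y => //= -[a b] [c d].
by rewrite lecE => /andP[].
Qed.

Lemma real_partM (x y : K) : 0 <= x -> real_part (x * y) = real_part x * real_part y.
Proof.
rewrite /real_part; case: k x y => //= -[a b] [c d].
by rewrite lecE /= => /andP[/eqP -> _]; rewrite mul0r subr0.
Qed.

Lemma real_part0 : real_part 0 = 0.
Proof. by rewrite /real_part; case: k. Qed.

Lemma rnorm_ge0 (V : normedZmodType K) (v : V) : 0 <= rnorm v.
Proof. by rewrite -real_part0; apply: ler_real_part. Qed.

Lemma ler_rnormD (V : normedZmodType K) (u v : V) :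
  rnorm (u + v) <= rnorm u + rnorm v.
Proof. by rewrite -real_partD; apply: ler_real_part; exact: ler_normD. Qed.

Lemma rnormM (x y : K) : rnorm (x * y) = rnorm x * rnorm y.
Proof. by rewrite /rnorm normrM real_partM. Qed.

Lemma rnorm0 (V : normedZmodType K) : rnorm (0 : V) = 0.
Proof. by rewrite /rnorm normr0 real_part0. Qed.

End Norms.

Section EllQ.
Variables (R : realType) (k : scalars) (I : choiceType).
Local Notation K := (scalar_field R k).

(* The value for [q = -oo] is irrelevant: only [0 < q] is used below. *)
Definition in_ell (q : \bar R) : set (I -> K) :=
  match q with
  | r%:E => [set f | (\esum_(i in [set: I]) (rnorm (f i) `^ r)%:E < +oo)%E]
  | +oo%E => [set f | exists M : R, forall i, rnorm (f i) <= M]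
  | -oo%E => set0
  end.

Lemma in_ell_submod (q : \bar R) : (0 < q)%E -> submod_closed [in in_ell q].
Proof.
case: q => [r| |//]; rewrite ?lte_fin => r0; split.
- rewrite inE /= esum1 // => i _.
  by rewrite rnorm0 powR0 // gt_eqF.
- move=> a f g; rewrite !inE /= => fr gr.
  have b0 (x : R) : 0 <= x -> (0 <= (x `^ r)%:E)%E by rewrite lee_fin powR_ge0.
  pose F i := ((2 * rnorm a) `^ r * rnorm (f i) `^ r)%:E.
  pose G i := (2 `^ r * rnorm (g i) `^ r)%:E.
  apply: (@le_lt_trans _ _ (\esum_(i in [set: I]) (F i + G i))).
    apply: le_esum => i _; rewrite /F /G -EFinD lee_fin.
    rewrite -!powRM ?mulr_ge0 ?rnorm_ge0 //.
    set x := rnorm (f i); set y := rnorm (g i).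
    have x0 : 0 <= rnorm a * x by rewrite mulr_ge0 ?rnorm_ge0.
    have y0 : 0 <= y by exact: rnorm_ge0.
    have h : rnorm (a * f i + g i) <= rnorm a * x + y.
      by rewrite (le_trans (ler_rnormD _ _)) // rnormM.
    have [xy|/ltW xy] := leP (rnorm a * x) y.
      apply: (@le_trans _ _ ((2 * y) `^ r)); last by rewrite lerDr powR_ge0.
      apply: ge0_ler_powR; rewrite ?nnegrE ?rnorm_ge0 ?mulr_ge0 // ?(ltW r0) //.
      by apply: (le_trans h); rewrite mulr_natl mulr2n lerD2r.
    apply: (@le_trans _ _ ((2 * rnorm a * x) `^ r)); last by rewrite lerDl powR_ge0.
    apply: ge0_ler_powR; rewrite ?nnegrE ?rnorm_ge0 ?mulr_ge0 ?rnorm_ge0 // ?(ltW r0) //.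
    by apply: (le_trans h); rewrite -mulrA mulr_natl mulr2n lerD2l.
  rewrite esumD; last 2 first.
  - by move=> i _; rewrite lee_fin mulr_ge0 ?powR_ge0.
  - by move=> i _; rewrite lee_fin mulr_ge0 ?powR_ge0.
  have Z (c : R) (h : I -> K) : 0 <= c ->
      (\esum_(i in [set: I]) (rnorm (h i) `^ r)%:E < +oo)%E ->
      (\esum_(i in [set: I]) (c * rnorm (h i) `^ r)%:E < +oo)%E.
    move=> c0 hr.
    apply: (@le_lt_trans _ _ (c%:E * \esum_(i in [set: I]) (rnorm (h i) `^ r)%:E)%E).
      apply: ge_ereal_sup => _ [X XF <-] /=.
      under eq_fsbigr do rewrite EFinM.
      rewrite -ge0_mule_fsumr; last by move=> i; rewrite lee_fin powR_ge0.
      by apply: lee_wpmul2l; [rewrite lee_fin|apply: ereal_sup_ubound; exists X].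
    by rewrite lte_mul_pinfty ?lee_fin.
  by rewrite lte_add_pinfty // Z // powR_ge0.
- by rewrite inE /=; exists 0 => i; rewrite rnorm0.
- move=> a f g; rewrite !inE /= => -[M fM] [N gN].
  exists (rnorm a * M + N) => i.
  rewrite (le_trans (ler_rnormD _ _)) // lerD // rnormM.
  by rewrite ler_wpM2l ?rnorm_ge0.
Qed.

Record ell (q : \bar R) (q0 : (0 < q)%E) := Ell {
  ell_val :> I -> K;
  ell_valP : ell_val \in in_ell q }.

Variables (q : \bar R) (q0 : (0 < q)%E).

HB.instance Definition _ := [isSub for @ell_val q q0].
HB.instance Definition _ := [Choice of ell q0 by <:].
HB.instance Definition _ :=
  GRing.SubChoice_isSubLmodule.Build K (I -> K) [in in_ell q] (ell q0)
    (in_ell_submod q0).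

Definition ell_norm (f : ell q0) : R :=
  match q with
  | r%:E => fine (\esum_(i in [set: I]) (rnorm (f i) `^ r)%:E)%E `^ r^-1
  | +oo%E => sup [set rnorm (f i) | i in [set: I]]
  | -oo%E => 0
  end.

End EllQ.

Section Summing.
Variable R : realType.

(* [mixed_pow p r x] is the [p]-th power of the [l_r] norm of [x], so that the
   recursion produces the exponents r_(k-1) / r_k of nested sums.  Multi-indices
   are [m.-tuple nat], the index i_k >= 1 being encoded by i_k - 1. *)
Fixpoint mixed_pow (p : R) (m : nat) :
    m.-tuple R -> (m.-tuple nat -> \bar R) -> \bar R :=
  match m with
  | 0 => fun _ x => x [tuple] `^ p
  | n.+1 => fun r x =>
      (\sum_(0 <= i <oo)
         mixed_pow (thead r) (behead_tuple r) (fun j => x (cons_tuple i j)))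
      `^ (p / thead r)
  end%E.

Variable k : scalars.
Local Notation K := (scalar_field R k).

Definition mixed_norm (F : lmodType K) (normF : F -> R) (m : nat)
    (r : m.-tuple R) (x : m.-tuple nat -> F) : \bar R :=
  mixed_pow 1 r (fun i => (normF (x i))%:E).

Definition dual_norm (E : normedModType K) (phi : E -> K) : \bar R :=
  ereal_sup [set (rnorm (phi x))%:E | x in [set x : E | rnorm x <= 1]].

Definition dual_ball (E : normedModType K) : set {linear E -> K} :=
  [set phi | continuous phi /\ (dual_norm phi <= 1)%E].

Definition weak_norm (E : normedModType K) (s : R) (N : nat) (x : nat -> E) :
    \bar R :=
  ereal_sup [set ((\sum_(i < N) rnorm (phi (x i)) `^ s) `^ s^-1)%:E
            | phi in @dual_ball E].

Variables (m : nat) (E : 'I_m -> completeNormedModType K).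
Variables (F : lmodType K) (normF : F -> R).

Definition multilinear (T : (forall j, E j) -> F) : Prop :=
  forall (x : forall j, E j) (j : 'I_m),
    linear (fun u : E j => T (dfwith x j u)).

Definition summing_bound (Lambda : set (m.-tuple nat)) (r s : m.-tuple R)
    (T : (forall j, E j) -> F) : Prop :=
  exists2 C : R, 0 < C &
  forall (N : nat) (x : forall j, nat -> E j), (0 < N)%N ->
  (forall j i, (N <= i)%N -> x j i = 0) ->
  (mixed_norm normF r
     (patch (fun=> 0%R) Lambda (fun i => T (fun j => x j (tnth i j))))
   <= C%:E * \prod_(j < m) weak_norm (tnth s j) N (x j))%E.

Definition summing (Lambda : set (m.-tuple nat)) (r s : m.-tuple R) :
    set ((forall j, E j) -> F) :=
  [set T | multilinear T /\ summing_bound Lambda r s T].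

End Summing.

Arguments ell_norm {R k} I {q} q0 f.
Arguments summing {R k m} E {F} normF Lambda r s.

(* Main.v *)
(** Both summing classes are linear subspaces of the space of multilinear maps,
    so only the codimension of the second one in the first matters.  Since [I]
    is infinite, [I * I] injects into [I], and a map [T] that belongs to the
    first class only can be transplanted onto each of [card I] disjoint copies
    of [I] inside [I].  The copies have the same norms as [T], and restricting a
    finite linear combination to the support of a single copy shows that they
    are linearly independent modulo the second class.  Given [W] of dimension
    [< card I] meeting the second class trivially, extend a Hamel basis of the
    intersection of the two classes and the copies to a Hamel basis [C] of the
    first class: a basis of [W] involves fewer than [card I] elements of [C], so
    [card I] many copies are not involved and can be added to [W]. *)
From HB Require Import structures.
From mathcomp Require Import all_boot all_order all_algebra finmap.
From mathcomp Require Import all_classical all_reals all_analysis.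
Require Import Defs.

Set Implicit Arguments.
Unset Strict Implicit.
Unset Printing Implicit Defensive.

Import Order.TTheory GRing.Theory Num.Theory.
Import numFieldNormedType.Exports.

Local Open Scope classical_set_scope.
Local Open Scope card_scope.
Local Open Scope ring_scope.

(** * Cardinals *)

(** Any choice of values of such a relation is injective, so [R] need not be single-valued.
    Injections can thus be composed and glued by describing relations only. *)
Lemma card_le_relP T U (A : set T) (B : set U) :
  A #<= B <-> exists R : T -> U -> Prop,
    (forall x, A x -> exists2 y, B y & R x y) /\
    (forall x x' y, A x -> A x' -> R x y -> R x' y -> x = x').
Proof.
split=> [/card_leP[f]|[R [Rtot Rinj]]].
  exists (fun x y => exists Ax : x \in A, y = set_val (f (SigSub Ax))).
  split=> [x Ax|x x' y Ax Ax' [xA ->] [x'A /val_inj]].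
    by exists (set_val (f (SigSub (mem_set Ax)))); [apply: set_valP|exists (mem_set Ax)].
  by move=> /(@inj _ _ _ f _ _ (mem_setT _) (mem_setT _)) [].
have [->|/set0P[x0 /Rtot[y0 _ _]]] := eqVneq A set0; first exact: card_ge0.
have /choice[f fP] x : exists y, A x -> B y /\ R x y.
  by have [/Rtot[y]|nAx] := pselect (A x); [exists y|exists y0].
have : $|{injfun A >-> B}|.
  apply/injfunPex; exists f => [x /fP[]//|x x' /set_mem Ax /set_mem Ax' fx].
  by apply: (Rinj x x' (f x)) => //; [case: (fP x)|rewrite fx; case: (fP x')].
by case=> g; apply: inj_card_le g.
Qed.

Lemma card_leX T T' U U' (A : set T) (A' : set T') (B : set U) (B' : set U') :
  A #<= A' -> B #<= B' -> A `*` B #<= A' `*` B'.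
Proof.
move=> /card_le_relP[R [Rtot Rinj]] /card_le_relP[S [Stot Sinj]].
apply/card_le_relP; exists (fun p q => R p.1 q.1 /\ S p.2 q.2).
split=> [[x y] [/= /Rtot[x' ? ?] /Stot[y' ? ?]]|]; first by exists (x', y').
move=> [x y] [x' y'] [z w] /= [/= ? ?] [/= ? ?] [? ?] [? ?].
by congr pair; [apply: Rinj|apply: Sinj]; eassumption.
Qed.

(** Zorn's lemma is applied to the sets whose union with [X0] satisfies [P]. The empty chain is then
    covered by [P X0], so only unions of non-empty chains have to be checked. *)
Lemma Zorn_above T (P : set (set T)) (X0 : set T) : P X0 ->
  (forall F : set (set T), F !=set0 -> F `<=` P -> total_on F subset ->
     P (\bigcup_(X in F) X)) ->
  exists X, [/\ X0 `<=` X, P X & forall Y, X `<=` Y -> P Y -> Y = X].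
Proof.
move=> PX0 PF; have [] := @Zorn_bigcup T (fun X => P (X0 `|` X)); last first.
  move=> X [PX Xmax]; exists (X0 `|` X); split; [exact: subsetUl|by []|].
  move=> Y XY PY.
  apply/seteqP; split=> // y Yy; apply: contrapT => nXy; apply: (Xmax Y).
    by split=> [x Xx|YX]; [apply: XY; right|apply: nXy; right; apply: YX].
  have -> : X0 `|` Y = Y by apply/setUidPr => x X0x; apply: XY; left.
  exact: PY.
move=> F FP Ftot; have [->|/set0P[X1 FX1]] := eqVneq F set0.
  by rewrite bigcup_set0 setU0.
have -> : X0 `|` \bigcup_(X in F) X =
    \bigcup_(X in [set X0 `|` Z | Z in F]) X.
  apply/seteqP; split=> [x [X0x|[X FX Xx]]|x [_ [X FX <-] [X0x|Xx]]].
  + by exists (X0 `|` X1); [exists X1|left].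
  + by exists (X0 `|` X); [exists X|right].
  + by left.
  + by right; exists X.
apply: PF; first by exists (X0 `|` X1), X1.
  by move=> _ [X /FP PX <-].
move=> _ _ [X FX <-] [Y FY <-].
by have [XY|YX] := Ftot _ _ FX FY; [left|right]; apply: setUS.
Qed.

(** Take a maximal graph [G] of a partial injection from [A] to [B]. If some [a] in [A] and some [b]
    in [B] were both unmatched, the pair could be added to [G]; so [G] exhausts [A] or [B]. *)
Lemma card_le_total T U (A : set T) (B : set U) : A #<= B \/ B #<= A.
Proof.
pose P (G : set (T * U)) := [/\ G `<=` A `*` B,
  (forall x x' y, G (x, y) -> G (x', y) -> x = x') &
  (forall x y y', G (x, y) -> G (x, y') -> y = y')].
have [||G [_ [GAB Ginj Gfun] Gmax]] := @Zorn_above _ P set0.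
- by split=> [[]|?????|?????].
- move=> F F0 FP Ftot; split=> [p [X /FP[XAB _ _]]|x x' y|x y y'].
  + exact: XAB.
  + move=> [X FX Xxy] [Y FY Yxy].
    by have [XY|YX] := Ftot _ _ FX FY;
      [have [_ + _] := FP _ FY|have [_ + _] := FP _ FX]; apply; eauto.
  + move=> [X FX Xxy] [Y FY Yxy].
    by have [XY|YX] := Ftot _ _ FX FY;
      [have [_ _] := FP _ FY|have [_ _] := FP _ FX]; apply; eauto.
have [totA|] := pselect (forall x, A x -> exists y, G (x, y)).
  left; apply/card_le_relP; exists (fun x y => G (x, y)).
  split=> [x /totA[y Gxy]|x x' y _ _]; last exact: Ginj.
  by exists y => //; have [] := GAB _ Gxy.
move=> /existsNP[a /not_implyP[Aa /forallNP na]].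
have totB b : B b -> exists x, G (x, b).
  move=> Bb; apply: contrapT => /forallNP nb; apply: (na b).
  rewrite -(Gmax (G `|` [set (a, b)])); [by right|exact: subsetUl|].
  split=> [p [/GAB//|->//]|x x' y|x y y'].
  - move=> [Gxy|[xa yb]] [Gx'y|[x'a yb']].
    + exact: Ginj Gxy Gx'y.
    + by case: (nb x); rewrite -yb'.
    + by case: (nb x'); rewrite -yb.
    + by rewrite xa x'a.
  - move=> [Gxy|[xa yb]] [Gxy'|[xa' yb']].
    + exact: Gfun Gxy Gxy'.
    + by case: (na y); rewrite -xa'.
    + by case: (na y'); rewrite -xa.
    + by rewrite yb yb'.
right; apply/card_le_relP; exists (fun y x => G (x, y)).
split=> [y /totB[x Gxy]|y y' x _ _]; last exact: Gfun.
by exists x => //; have [] := GAB _ Gxy.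
Qed.

Lemma infinite_two_points T (A : set T) : infinite_set A ->
  exists x y, [/\ A x, A y & x <> y].
Proof.
move=> Ainf; have [x Ax] := infinite_setN0 Ainf.
have [y [Ay /= yx]] : A `\ x !=set0.
  apply: infinite_setN0 => fin; apply: Ainf; rewrite -(setD1K Ax) finite_setU.
  by split=> //; apply: finite_set1.
by exists x, y; split=> // xy; apply: yx.
Qed.

(** Two distinct points [c], [d] of [C] serve as tags: [A] goes into the slice over [c] and the rest
    of [B] into the slice over [d] of the square of [C]. *)
Lemma card_leU_square T V (A : set T) (B : set T) (C : set V) :
  infinite_set C -> C `*` C #<= C -> A #<= C -> B #<= C -> A `|` B #<= C.
Proof.
move=> /infinite_two_points[c [d [Cc Cd cd]]] CC.
move=> /card_le_relP[R [Rtot Rinj]] /card_le_relP[S [Stot Sinj]].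
apply: card_le_trans CC; apply/card_le_relP.
exists (fun x p => (A x /\ p.1 = c /\ R x p.2) \/ (~ A x /\ p.1 = d /\ S x p.2)).
split=> [x ABx|x x' [e z] ABx ABx' /=].
  have [Ax|nAx] := pselect (A x).
    by have [z Cz Rxz] := Rtot x Ax; exists (c, z) => //; left.
  have [//|Bx] := ABx; have [z Cz Sxz] := Stot x Bx.
  by exists (d, z) => //; right.
move=> [[Ax [-> Rxz]]|[nAx [-> Sxz]]] [[Ax' [e' Rx'z]]|[nAx' [e' Sx'z]]].
- exact: Rinj Rx'z.
- by case: cd.
- by case: cd.
- by apply: (Sinj _ _ z) => //; [case: ABx|case: ABx'].
Qed.

(* Take a maximal [X] with an injection [X * X -> X].  If [X] injected into
   [A `\` X], with image [Y], then [(X + Y)^2] would inject into [Y] and the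
   injection would extend to [X + Y]; so [A] injects into [X + X], hence into [X].
   Injections are encoded by their graphs, [fld] being the set [X]. *)
Lemma card_square T (A : set T) : infinite_set A -> A `*` A #<= A.
Proof.
move=> Ainf.
pose fld (G : set (T * T * T)) := [set x | exists z, G (x, x, z)].
pose P (G : set (T * T * T)) := [/\ fld G `<=` A,
  (forall x y z, G (x, y, z) -> [/\ fld G x, fld G y & fld G z]),
  (forall x y, fld G x -> fld G y -> exists z, G (x, y, z)) &
  (forall p q z, G (p, z) -> G (q, z) -> p = q)].
have fldS G H : G `<=` H -> fld G `<=` fld H.
  by move=> GH x [z Gz]; exists z; apply: GH.
have PcardX G : P G -> fld G `*` fld G #<= fld G.
  move=> [_ Gfld Gtot Ginj]; apply/card_le_relP; exists (fun p z => G (p, z)).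
  split=> [[x y] [/= /Gtot /[apply] -[z Gz]]|p q z _ _]; last exact: Ginj.
  by exists z => //; have [] := Gfld _ _ _ Gz.
have ext G Y : P G -> Y `<=` A -> (forall x, Y x -> ~ fld G x) ->
    (fld G `|` Y) `*` (fld G `|` Y) #<= Y ->
    exists H, [/\ G `<=` H, P H & fld H = fld G `|` Y].
  move=> PG YA Yfld /card_le_relP[R [Rtot Rinj]].
  have [GA Gfld Gtot Ginj] := PG; set Z := fld G `|` Y.
  (* Only pairs outside the square of [fld G] receive new values. These lie in [Y], which is
     disjoint from [fld G], so old and new values never collide. *)
  pose H := G `|` [set t : T * T * T | [/\ Z t.1.1, Z t.1.2,
    ~ (fld G t.1.1 /\ fld G t.1.2), Y t.2 & R t.1 t.2]].
  have ZfldH x : Z x -> fld H x.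
    move=> Zx; have [Gx|nGx] := pselect (fld G x).
      by have [z Gz] := Gtot _ _ Gx Gx; exists z; left.
    have [z Yz Rz] := Rtot (x, x) (conj Zx Zx).
    by exists z; right; split=> //= -[].
  have fldH : fld H = Z.
    apply/seteqP; split=> // x [z [Gxz|[/= Zx _ _ _ _]]] //.
    by left; exists z.
  exists H; split=> //; first exact: subsetUl.
  split; rewrite ?fldH.
  - by move=> x [/GA|/YA].
  - move=> x y z [/Gfld[]|[/= ]]; first by split; left.
    by move=> Zx Zy _ Yz _; split=> //; right.
  - move=> x y Zx Zy; have [[Gx Gy]|nG] := pselect (fld G x /\ fld G y).
      by have [z] := Gtot _ _ Gx Gy; exists z; left.
    by have [z Yz Rz] := Rtot (x, y) (conj Zx Zy); exists z; right.
  - move=> [p1 p2] [q1 q2] z [Gp|[/= p1Z p2Z _ Yz Rp]] [Gq|[/= q1Z q2Z _ Yz' Rq]].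
    + exact: Ginj Gp Gq.
    + by have [_ _ /Yfld] := Gfld _ _ _ Gp.
    + by have [_ _ /Yfld] := Gfld _ _ _ Gq.
    + exact: Rinj Rp Rq.
have P0 : P set0 by split=> [x []|x y z|x y []|p q z] //.
have fld0 : fld set0 = set0 by apply/seteqP; split=> // x [].
(* Starting from a countably infinite subset keeps the maximal field infinite. *)
have [N NA Nnat] : exists2 N : set T, N `<=` A & N #= [set: nat].
  by move/infiniteP: Ainf => /card_subP[N ? ?]; exists N.
have [G0 [_ PG0 fldG0]] : exists H, [/\ set0 `<=` H, P H & fld H = fld set0 `|` N].
  apply: ext => // [x _|]; first by rewrite fld0.
  rewrite fld0 set0U (card_le_eqr Nnat).
  apply: card_le_trans (_ : _ #<= [set: nat * nat]) _.
    rewrite -setXTT; apply: card_leX; rewrite (card_le_eql Nnat); exact: card_lexx.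
  by rewrite (card_le_eql card_nat2) card_lexx.
have [|G [G0G PG Gmax]] := @Zorn_above _ P G0 PG0.
  move=> F [X0 FX0] FP Ftot; split.
  - by move=> x [z [X FX Xx]]; have [+ _ _ _] := FP _ FX; apply; exists z.
  - move=> x y z [X FX Xxyz]; have [_ /(_ _ _ _ Xxyz)[? ? ?] _ _] := FP _ FX.
    by split; apply: (fldS X) => //; apply: bigcup_sup.
  - move=> x y [z [X FX Xxz]] [w [Y FY Yyw]].
    have [XY|YX] := Ftot _ _ FX FY.
      have [_ _ /(_ x y) + _] := FP _ FY; case; first by exists z; apply: XY.
        by exists w.
      by move=> v Yv; exists v, Y.
    have [_ _ /(_ x y) + _] := FP _ FX; case; first by exists z.
      by exists w; apply: YX.
    by move=> v Xv; exists v, X.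
  - move=> p q z [X FX Xp] [Y FY Yq].
    by have [XY|YX] := Ftot _ _ FX FY;
      [have [_ _ _] := FP _ FY|have [_ _ _] := FP _ FX]; apply; eauto.
set X := fld G; have XX : X `*` X #<= X := PcardX _ PG.
have XA : X `<=` A by have [] := PG.
have Xinf : infinite_set X.
  apply/infiniteP; rewrite -(card_le_eql Nnat); apply: subset_card_le.
  by rewrite -[N]set0U -fld0 -fldG0; apply: fldS.
have [AXX|/card_subP[Y YX YAX]] := card_le_total (A `\` X) X.
  have AX : A #<= X.
    rewrite -(setDUK XA); apply: card_leU_square => //.
  apply: card_le_trans (card_leX AX AX) _; apply: card_le_trans XX _.
  exact: subset_card_le.
have [H [GH PH fldH]] : exists H, [/\ G `<=` H, P H & fld H = fld G `|` Y].
  apply: ext => // [x /YAX[]//|x /YAX[]//|].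
  have XYX : X `|` Y #<= X by apply: card_leU_square; rewrite // (card_le_eql YX).
  by rewrite (card_le_eqr YX); apply: card_le_trans XX; apply: card_leX.
have [x Xx] := infinite_setN0 Xinf.
have [y Yy] : Y !=set0.
  by apply: infinite_setN0 => finY; apply: Xinf; rewrite -(eq_finite_set YX).
case: (YAX _ Yy) => _; case; rewrite /X -(Gmax _ GH PH) fldH; right.
exact: Yy.
Qed.

(** An element of the union is determined by some [i] with [u] in [F i] and by its position in the
    enumeration of [F i]; pairs of this kind inject into the square of [A]. *)
Lemma card_bigcup_fset T (U : choiceType) (A : set T) (F : T -> {fset U}) :
  infinite_set A -> \bigcup_(i in A) [set` F i] #<= A.
Proof.
move=> Ainf; apply: card_le_trans (card_square Ainf).
apply: card_le_trans (card_leX (card_lexx A) ((infiniteP A).1 Ainf)).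
apply/card_le_relP.
exists (fun u p => u \in F p.1 /\ index u (F p.1) = p.2).
split=> [u [i Ai /= uFi]|u v [i n] _ _ /= [uF <-] [vF]].
  by exists (i, index u (F i)).
by move=> /(congr1 (nth u (F i))); rewrite !nth_index.
Qed.

Lemma bigcup_fset_small T (U : choiceType) V (A : set T) (F : T -> {fset U})
    (B : set V) :
  infinite_set B -> ~ (B #<= A) -> ~ (B #<= \bigcup_(i in A) [set` F i]).
Proof.
move=> Binf BA BF; have [Afin|Ainf] := pselect (finite_set A).
  by apply: Binf; apply: card_le_finite BF _; apply: bigcup_finite.
by apply: BA; apply: card_le_trans BF (card_bigcup_fset _ Ainf).
Qed.

(** * Hamel bases and lineability *)

Section Hamel.
Variables (K : fieldType) (L : lmodType K).
Implicit Types (B D V W X Y : set L) (Z : {fset L}) (c : L -> K).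

Lemma subspaceP W : subspace W <->
  W 0 /\ forall a u v, W u -> W v -> W (a *: u + v).
Proof.
split=> [[W0 WZD]|[W0 WZD]].
  split=> [|a u v /mem_set Wu /mem_set Wv]; first exact: set_mem W0.
  exact: set_mem (WZD a u v Wu Wv).
by split=> [|a u v /set_mem Wu /set_mem Wv]; apply/mem_set; [|apply: WZD].
Qed.

Lemma subspaceD W u v : subspace W -> W u -> W v -> W (u + v).
Proof. by move=> /subspaceP[_ WZD] Wu Wv; rewrite -[u]scale1r; apply: WZD. Qed.

Lemma subspaceZ W a u : subspace W -> W u -> W (a *: u).
Proof. by move=> /subspaceP[W0 WZD] Wu; rewrite -[X in W X]addr0; apply: WZD. Qed.

Lemma subspaceB W u v : subspace W -> W u -> W v -> W (u - v).
Proof.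
by move=> Wsub Wu Wv; rewrite -scaleN1r; apply: subspaceD => //; apply: subspaceZ.
Qed.

Lemma subspaceI V W : subspace V -> subspace W -> subspace (V `&` W).
Proof.
move=> /subspaceP[V0 VZD] /subspaceP[W0 WZD]; apply/subspaceP.
by split=> // a u v [Vu Wu] [Vv Wv]; split; [apply: VZD|apply: WZD].
Qed.

Lemma subspace_sum W (J : eqType) (r : seq J) (P : pred J) (F : J -> L) :
  subspace W -> (forall j, j \in r -> P j -> W (F j)) -> W (\sum_(j <- r | P j) F j).
Proof.
move=> Wsub WF; rewrite big_seq_cond; elim/big_ind: _.
- by have /subspaceP[] := Wsub.
- by move=> u v; apply: subspaceD.
- by move=> j /andP[]; apply: WF.
Qed.

Lemma lin_span_sub B : B `<=` lin_span B.
Proof.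
move=> u Bu; exists [fset u]%fset, (fun=> 1).
by rewrite big_seq_fset1 scale1r; split=> // v /=; rewrite inE => /eqP ->.
Qed.

Lemma lin_span_min B W : subspace W -> B `<=` W -> lin_span B `<=` W.
Proof.
move=> Wsub BW _ [Z [c [ZB ->]]]; apply: subspace_sum => // u uZ _.
by apply: subspaceZ => //; apply/BW/ZB.
Qed.

Lemma sum_widen Z Z' c : (Z `<=` Z')%fset ->
  \sum_(u <- Z) c u *: u = \sum_(u <- Z') (if u \in Z then c u else 0) *: u.
Proof.
move=> ZZ'; rewrite -(big_fset_incl _ ZZ'); last first.
  by move=> u _ /negbTE ->; rewrite scale0r.
by apply: eq_big_seq => u ->.
Qed.

Lemma lin_span_subspace B : subspace (lin_span B).
Proof.
apply/subspaceP; split.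
  by exists fset0, (fun=> 0); rewrite big_seq_fset0; split=> // u.
move=> a _ _ [Z [c [ZB ->]]] [Z' [c' [ZB' ->]]].
exists (Z `|` Z')%fset,
  (fun u => (if u \in Z then a * c u else 0) + (if u \in Z' then c' u else 0)).
split=> [u /=|]; first by rewrite inE => /orP[/ZB|/ZB'].
rewrite scaler_sumr; under eq_bigr do rewrite scalerA.
rewrite (sum_widen _ (fsubsetUl Z Z')) (sum_widen _ (fsubsetUr Z Z')) -big_split /=.
by apply: eq_bigr => u _; rewrite scalerDl.
Qed.

Lemma lin_spanS B D : B `<=` D -> lin_span B `<=` lin_span D.
Proof.
by move=> BD; apply: lin_span_min (lin_span_subspace _) _ => u /BD /lin_span_sub.
Qed.

Lemma lin_span_lin_span B D : D `<=` lin_span B -> lin_span D `<=` lin_span B.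
Proof. exact: lin_span_min (lin_span_subspace _). Qed.

Lemma sum_span B Z c : (forall u, u \in Z -> c u != 0 -> B u) ->
  lin_span B (\sum_(u <- Z) c u *: u).
Proof.
move=> cB; apply: subspace_sum; first exact: lin_span_subspace.
move=> u uZ _; have [->|c0] := eqVneq (c u) 0.
  by rewrite scale0r; have /subspaceP[] := lin_span_subspace B.
by apply: subspaceZ; [exact: lin_span_subspace|apply/lin_span_sub/cB].
Qed.

Lemma lin_indep_supp B Z c : lin_indep B ->
  (forall u, u \in Z -> c u != 0 -> B u) -> \sum_(u <- Z) c u *: u = 0 ->
  {in Z, forall u, c u = 0}.
Proof.
move=> Bindep cB sum0 u uZ; apply/eqP/negPn/negP => cu0.
pose Z' := [fset v in Z | c v != 0]%fset.
have Z'Z : (Z' `<=` Z)%fset by apply/fsubsetP => v; rewrite !inE => /andP[].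
case/negP: (cu0); apply/eqP/(Bindep Z').
- by move=> v /=; rewrite !inE => /andP[]; apply: cB.
- rewrite (big_fset_incl _ Z'Z) // => v vZ; rewrite !inE vZ /= negbK => /eqP ->.
  by rewrite scale0r.
- by rewrite !inE uZ.
Qed.

Lemma span_disjoint B X Y v : lin_indep B -> X `<=` B -> Y `<=` B ->
  X `&` Y = set0 -> lin_span X v -> lin_span Y v -> v = 0.
Proof.
move=> Bindep XB YB XY0 [Z [c [ZX vE]]] [Z' [c' [Z'Y vE']]].
rewrite vE big_seq big1 // => u uZ; suff -> : c u = 0 by rewrite scale0r.
(* These are the coefficients of [v - v] obtained from the two expansions. At [u], which is in [Z]
   but not in [Z'], the coefficient is [c u]. *)
pose d w := (if w \in Z then c w else 0) - (if w \in Z' then c' w else 0).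
have uZ' : u \notin Z'.
  apply/negP => uZ'; have XYu : (X `&` Y) u by split; [apply: ZX|apply: Z'Y].
  by rewrite XY0 in XYu.
have := @Bindep (Z `|` Z')%fset d.
have -> : c u = d u by rewrite /d uZ (negbTE uZ') subr0.
apply; last by rewrite inE uZ.
  by move=> w /=; rewrite inE => /orP[/ZX/XB|/Z'Y/YB].
transitivity (v - v); last by rewrite subrr.
rewrite {1}vE vE' (sum_widen _ (fsubsetUl Z Z')) (sum_widen _ (fsubsetUr Z Z')) -sumrB.
by apply: eq_bigr => w _; rewrite scalerBl.
Qed.

Lemma lin_spanU X Y v : lin_span (X `|` Y) v ->
  exists2 x, lin_span X x & exists2 y, lin_span Y y & v = x + y.
Proof.
apply: (@lin_span_min (X `|` Y)
  [set v | exists2 x, lin_span X x & exists2 y, lin_span Y y & v = x + y]); last first.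
  have z0 B : lin_span B 0 by have /subspaceP[] := lin_span_subspace B.
  move=> u [Xu|Yu].
    exists u; first exact: lin_span_sub.
    by exists 0; rewrite ?addr0.
  by exists 0 => //; exists u; rewrite ?add0r //; apply: lin_span_sub.
have /subspaceP[X0 XZD] := lin_span_subspace X.
have /subspaceP[Y0 YZD] := lin_span_subspace Y.
apply/subspaceP; split; first by exists 0 => //; exists 0; rewrite ?addr0.
move=> a _ _ [x Xx [y Yy ->]] [x' Xx' [y' Yy' ->]].
exists (a *: x + x'); first exact: XZD.
by exists (a *: y + y'); [exact: YZD|rewrite scalerDr addrACA].
Qed.

(** Split a vanishing combination into its terms in [X] and the remaining ones. Each part is the
    opposite of the other, hence lies in both spans and vanishes. *)
Lemma lin_indepU X Y : lin_indep X -> lin_indep Y ->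
  (forall v, lin_span X v -> lin_span Y v -> v = 0) -> lin_indep (X `|` Y).
Proof.
move=> Xindep Yindep XY0 Z c ZXY sum0.
pose cX u := if u \in X then c u else 0.
pose cY u := if u \in X then 0 else c u.
have cE u : c u = cX u + cY u by rewrite /cX /cY; case: ifP; rewrite (addr0, add0r).
have cXX u : u \in Z -> cX u != 0 -> X u.
  by move=> _; rewrite /cX; case: ifPn => [/set_mem|]; rewrite ?eqxx.
have cYY u : u \in Z -> cY u != 0 -> Y u.
  move=> /ZXY XYu; rewrite /cY; case: ifPn; rewrite ?eqxx // => /negP uX _.
  by case: XYu => // /mem_set.
have sumE : \sum_(u <- Z) c u *: u =
    \sum_(u <- Z) cX u *: u + \sum_(u <- Z) cY u *: u.
  by rewrite -big_split; apply: eq_bigr => u _ /=; rewrite -scalerDl -cE.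
have sumX0 : \sum_(u <- Z) cX u *: u = 0.
  apply: XY0; first exact: sum_span.
  have -> : \sum_(u <- Z) cX u *: u = (-1) *: \sum_(u <- Z) cY u *: u.
    by apply/eqP; rewrite scaleN1r -addr_eq0 -sumE sum0.
  by apply: subspaceZ (lin_span_subspace _) _; apply: sum_span.
move: sumE; rewrite sum0 sumX0 add0r => /esym sumY0 u uZ.
by rewrite cE (lin_indep_supp Xindep cXX) // (lin_indep_supp Yindep cYY) // addr0.
Qed.

Lemma lin_indep1 (v : L) : v != 0 -> lin_indep [set v].
Proof.
move=> v0 Z c Zv sum0 u uZ; have uv : u = v := Zv u uZ.
have Z1 : Z = [fset v]%fset.
  by apply/fsetP => w; rewrite inE; apply/idP/eqP => [/Zv//|->]; rewrite -uv.
move: sum0; rewrite Z1 big_seq_fset1 uv => /eqP; rewrite scaler_eq0 (negbTE v0) orbF.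
by move=> /eqP.
Qed.

(** Induction on an enumeration of [Z]: of two members of the chain the larger one contains both.
    This makes linear independence pass to unions of chains. *)
Lemma fset_sub_chain (F : set (set L)) Z : F !=set0 -> total_on F subset ->
  [set` Z] `<=` \bigcup_(X in F) X -> exists2 X, F X & [set` Z] `<=` X.
Proof.
move=> [X0 FX0] Ftot; have [s Es] : exists s : seq L, s =i Z by exists Z.
suff H : (forall u, u \in s -> (\bigcup_(X in F) X) u) ->
    exists2 X, F X & forall u, u \in s -> X u.
  move=> ZF; have [u us|X FX sX] := H; first by apply: ZF; rewrite /= -Es.
  by exists X => // u /=; rewrite -Es; apply: sX.
elim: s {Es} => [_|u s IH usF]; first by exists X0.
have [v vs|X FX sX] := IH; first by apply: usF; rewrite inE vs orbT.
have [Y FY Yu] := usF u (mem_head _ _).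
have [XY|YX] := Ftot _ _ FX FY.
  by exists Y => // v; rewrite inE => /orP[/eqP->//|/sX/XY].
by exists X => // v; rewrite inE => /orP[/eqP->|/sX//]; apply: YX.
Qed.

(** A maximal independent subset of [V] above [X] spans [V], since a vector outside its span could
    be added to it. *)
Lemma hamel_basis_extension V X : subspace V -> lin_indep X -> X `<=` V ->
  exists2 B, X `<=` B & hamel_basis V B.
Proof.
move=> Vsub Xindep XV.
pose P B := lin_indep B /\ B `<=` V.
have [||B [XB [Bindep BV] Bmax]] := @Zorn_above _ P X; first by split.
  move=> F F0 FP Ftot; split=> [Z c ZF|u [Y /FP[_ YV] Yu]]; last exact: YV.
  have [Y FY ZY] := fset_sub_chain F0 Ftot ZF.
  by have [+ _] := FP _ FY; apply.
exists B => //; split=> //; apply/seteqP; split; first exact: lin_span_min.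
move=> v Vv; apply: contrapT => nBv.
have v0 : v != 0.
  by apply/eqP => v0; apply: nBv; rewrite v0; have /subspaceP[] := lin_span_subspace B.
apply: (nBv); apply: lin_span_sub; rewrite -(Bmax (B `|` [set v]));
  [by right|exact: subsetUl|].
split=> [|u [/BV//|->//]]; apply: lin_indepU => //; first exact: lin_indep1.
move=> w Bw [Z [c [Zv wE]]]; apply: contrapT => /eqP w0; apply: nBv.
have [a wa] : exists a, w = a *: v.
  exists (\sum_(u <- Z) c u); rewrite wE scaler_suml.
  by apply: eq_big_seq => u /Zv ->.
have a0 : a != 0 by apply: contraNneq w0 => a0; rewrite wa a0 scale0r.
by rewrite -[v](scalerK a0) -wa; apply: subspaceZ (lin_span_subspace _) _.
Qed.

End Hamel.

(** * Lineability of the difference of two subspaces *)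

Section Lineable.
Variables (K : fieldType) (L : lmodType K).
Implicit Types (B C D E U V W X Y : set L) (Z : {fset L}).

(* The vectors of [B] involve few elements of [C] while [E] splits into [E]-many
   disjoint copies of itself, so that one of these copies is not involved. *)
Lemma exists_avoiding_subset B C E : infinite_set E -> ~ (E #<= B) ->
  B `<=` lin_span C -> exists D X,
  [/\ D `<=` E, E #<= D, X `<=` C, B `<=` lin_span X & X `&` D = set0].
Proof.
move=> Einf EB BC; have /card_le_relP[R [Rtot Rinj]] := card_square Einf.
have /choice[F FP] u : exists Z, B u -> [set` Z] `<=` C /\ lin_span [set` Z] u.
  have [/BC[Z [c [ZC uE]]]|nBu] := pselect (B u); last by exists fset0.
  by exists Z => _; split=> //; exists Z, c; split.
pose X := \bigcup_(u in B) [set` F u].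
pose D a := [set v | E v /\ exists2 b, E b & R (a, b) v].
have [a [Ea aX]] : exists a, E a /\ X `&` D a = set0.
  apply: contrapT => /forallNP noa.
  (* If every slice [D a] met [X], the pairwise disjoint slices would inject [E] into [X], a union
     of finite sets indexed by the too small set [B]. *)
  apply: (bigcup_fset_small (F := F) Einf EB); apply/card_le_relP; exists D.
  split=> [a Ea|a a' v Ea Ea' [_ [b Eb Rab]] [_ [b' Eb' Rab']]].
    have /not_andP[//|/eqP/set0P[v [Xv Dv]]] := noa a.
    by exists v.
  by have [] : (a, b) = (a', b') by apply: Rinj Rab Rab'.
exists (D a), X; split=> //.
- by move=> v [].
- apply/card_le_relP; exists (fun b v => R (a, b) v); split=> [b Eb|b b' v Eb Eb'].
    have [v Ev Rv] := Rtot (a, b) (conj Ea Eb).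
    by exists v => //; split=> //; exists b.
  move=> Rab Rab'.
  by have [] : (a, b) = (a, b') by apply: Rinj Rab Rab'.
- by move=> v [u /FP[FC _]]; apply: FC.
- move=> u Bu; have [_] := FP u Bu; apply: lin_spanS => v Fv.
  by exists u.
Qed.

Lemma lin_indepS X Y : X `<=` Y -> lin_indep Y -> lin_indep X.
Proof. by move=> XY Yindep Z c ZX; apply: Yindep => u /ZX /XY. Qed.

Lemma lin_indep_neq0 X v : lin_indep X -> X v -> v != 0.
Proof.
move=> Xindep Xv; apply/eqP => v0.
have /eqP : (1 : K) = 0.
  apply: (Xindep [fset v]%fset (fun=> 1) _ _ v); rewrite ?inE //.
    by move=> u /=; rewrite inE => /eqP ->.
  by rewrite big_seq_fset1 scale1r.
by rewrite oner_eq0.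
Qed.

Section SetD.
Variables (V U E : set L) (I : Type) (S : set I).
Hypotheses (Vsub : subspace V) (Usub : subspace U) (EV : E `<=` V).
Hypotheses (Eindep : lin_indep E) (EU : forall v, lin_span E v -> U v -> v = 0).
Hypotheses (Sinf : infinite_set S) (ES : E #= S).

Let Einf : infinite_set E.
Proof. by move=> Efin; apply: Sinf; rewrite -(eq_finite_set ES). Qed.

Let subD W : (W `<=` (V `\` U) `|` [set 0]) <->
  W `<=` V /\ (forall v, W v -> U v -> v = 0).
Proof.
split=> [WVU|[WV WU] v Wv].
  split=> [v /WVU[[]//|->]|v /WVU[[_ nUv]|]//]; by have /subspaceP[] := Vsub.
by have [/(WU v Wv)|] := pselect (U v); [right|left; split=> //; apply: WV].
Qed.

(** A subset of [E] of the right size spans such a subspace, since the span of [E] meets [U] only in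
    0. *)
Let lineable_setD (T : Type) (alpha : set T) :
  alpha #<= S -> lineable V (V `\` U) alpha.
Proof.
rewrite -(card_le_eqr ES) => /card_subP[Y Ya YE].
have YV : lin_span Y `<=` V by apply: lin_span_min => // v /YE /EV.
exists (lin_span Y); split=> //; first exact: lin_span_subspace.
  by apply/subD; split=> // v /(lin_spanS YE); apply: EU.
by exists Y => //; split=> //; apply: lin_indepS Eindep.
Qed.

Lemma lineable2_setD (T : Type) (alpha : set T) : card_lt alpha S ->
  lineable2 V (V `\` U) alpha S.
Proof.
move=> aS; have [aleS nSa] := aS.
have indep0 : lin_indep (set0 : set L) by move=> Z c Z0 _ u /Z0.
have [BU _ [BUindep BUspan]] :=
  hamel_basis_extension (subspaceI Vsub Usub) indep0 (@sub0set _ _).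
have BUE : lin_indep (BU `|` E).
  apply: lin_indepU => // v; rewrite BUspan => -[_ Uv] Ev; exact: EU.
have [|C BUEC [Cindep Cspan]] := hamel_basis_extension Vsub BUE.
  by move=> v [BUv|/EV//]; have [] : (V `&` U) v by rewrite -BUspan; apply: lin_span_sub.
split=> //.
  exists C; rewrite // -(card_le_eql ES); apply: subset_card_le => v Ev.
  by apply: BUEC; right.
  exact: lineable_setD.
move=> W Wsub _ /subD[WV WU] [B [Bindep Bspan] Ba].
have [D [X [DE ED XC BX XD]]] : exists D X,
    [/\ D `<=` E, E #<= D, X `<=` C, B `<=` lin_span X & X `&` D = set0].
  apply: exists_avoiding_subset => //.
    by rewrite (card_le_eql ES) (card_le_eqr Ba).
  by rewrite Cspan => v Bv; apply: WV; rewrite -Bspan; apply: lin_span_sub.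
have EC v : E v -> C v by move=> Ev; apply: BUEC; right.
have BUC v : BU v -> C v by move=> BUv; apply: BUEC; left.
(* [D] misses [X] by choice, and misses [BU] because a vector of [E] lying in [U] would be zero. So
   two disjoint parts of the basis [C] are compared. *)
have XBUD v : lin_span (X `|` BU) v -> lin_span D v -> v = 0.
  apply: (span_disjoint Cindep).
  - by move=> u [/XC|/BUC].
  - by move=> u /DE/EC.
  - rewrite setIUl XD set0U; apply/seteqP; split=> // u [BUu /DE Eu].
    have /eqP := lin_indep_neq0 Eindep Eu; case; apply: EU; first exact: lin_span_sub.
    by have [] : (V `&` U) u by rewrite -BUspan; apply: lin_span_sub.
have WX v : W v -> lin_span (X `|` BU) v.
  by rewrite -Bspan => /(lin_span_lin_span BX); apply: lin_spanS; apply: subsetUl.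
have DV : lin_span D `<=` V by apply: lin_span_min => // v /DE/EV.
have W'V : lin_span (B `|` D) `<=` V.
  move=> _ /lin_spanU[w + [d Dd ->]]; rewrite Bspan => Ww.
  by apply: subspaceD; [|exact: WV|exact: DV].
exists (lin_span (B `|` D)); split=> //.
- exact: lin_span_subspace.
- exists (B `|` D).
    split=> //; apply: lin_indepU => //; first exact: lin_indepS Eindep.
    by move=> v; rewrite Bspan => /WX; apply: XBUD.
  apply/eqP; rewrite -(card_eqr ES); apply/eqP; rewrite card_eq_le; apply/andP; split.
    apply: card_leU_square (card_square Einf) _ (subset_card_le DE) => //.
    by rewrite (card_le_eqr ES) (card_le_eql Ba).
  by apply: card_le_trans ED (subset_card_le _); apply: subsetUr.
- by rewrite -Bspan; apply: lin_spanS; apply: subsetUl.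
- apply/subD; split=> // _ /lin_spanU[w + [d Dd ->]]; rewrite Bspan => Ww Uwd.
  (* Write [d] as [(w + d) - w]: the first term lies in the span of [BU], the second in that of [X]
     and [BU] together, while [d] is in the span of [D]. *)
  have d0 : d = 0.
    apply: XBUD => //; rewrite -(addKr w d) addrC.
    apply: subspaceB (lin_span_subspace _) _ (WX _ Ww).
    apply: (@lin_spanS _ _ BU); first exact: subsetUr.
    rewrite BUspan; split=> //; apply: subspaceD => //; [exact: WV|exact: DV].
  by rewrite d0 addr0 in Uwd *; apply: WU.
Qed.

End SetD.

(** If [e i = e j], the combination [e i - e j] is 0 and hence in [U], which forces [i = j].
    Choosing a preimage of each vector then turns combinations of vectors into combinations indexed
    by [J]. *)
Lemma range_indep_mod U (J : choiceType) (e : J -> L) : subspace U ->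
  (forall (Z : {fset J}) (c : J -> K), U (\sum_(j <- Z) c j *: e j) ->
    {in Z, forall j, c j = 0}) ->
  [/\ injective e, lin_indep (range e) &
     forall v, lin_span (range e) v -> U v -> v = 0].
Proof.
move=> /subspaceP[U0 _] indep.
have einj : injective e.
  move=> i j eij; apply/eqP/negPn/negP => ij.
  have /eqP : (1 : K) = 0; last by rewrite oner_eq0.
  pose c k : K := if k == i then 1 else -1.
  have <- : c i = 1 by rewrite /c eqxx.
  apply: (indep [fset i; j]%fset c); last by rewrite !inE eqxx.
  rewrite big_fsetU1 ?inE //= big_seq_fset1 /c eqxx eq_sym (negbTE ij).
  by rewrite scaleN1r scale1r eij subrr.
have coef0 Z c : [set` Z] `<=` range e -> U (\sum_(u <- Z) c u *: u) ->
    {in Z, forall u, c u = 0}.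
  move=> Ze sumU u0 u0Z; have [j0 _ _] := Ze u0 u0Z.
  have /choice[g gP] u : exists j, u \in Z -> e j = u.
    have [uZ|_] := boolP (u \in Z); last by exists j0.
    by have [j _ <-] := Ze u uZ; exists j.
  rewrite -(gP u0 u0Z); apply: (indep (g @` Z)%fset (c \o e)).
    rewrite big_imfset /=; last by move=> u v uZ vZ guv; rewrite -(gP u uZ) guv gP.
    rewrite (_ : \sum_(u <- Z) _ = \sum_(u <- Z) c u *: u) //.
    by apply: eq_big_seq => u uZ; rewrite gP.
  exact: in_imfset.
split=> // [Z c Ze sum0|_ [Z [c [Ze ->]]] sumU].
  by apply: coef0 Ze _; rewrite sum0.
by rewrite big_seq big1 // => u uZ; rewrite (coef0 _ _ Ze sumU) // scale0r.
Qed.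

End Lineable.

(** * Summing operators *)

Section MixedPow.
Variable R : realType.
Implicit Types (x y z : \bar R) (c p : R).
Local Open Scope ereal_scope.

(** The sum [y + z] is at most twice the larger term. This covers exponents below 1 too, as they
    occur among the quotients of successive [r] and for small [q]. *)
Lemma poweR_leD c p x y z : (0 < c)%R -> (0 <= p)%R ->
  0 <= x -> 0 <= y -> 0 <= z -> x <= c%:E * (y + z) ->
  x `^ p <= ((c * 2) `^ p)%:E * (y `^ p + z `^ p).
Proof.
move=> c0 p0 x0; have c20 : 0 <= (c * 2)%:E by rewrite lee_fin mulr_ge0 // ltW.
have pow_le u v : 0 <= u -> u <= v -> u `^ p <= v `^ p.
  move=> u0 uv; apply: gt0_ler_poweR => //; rewrite in_itv /= ?leey ?andbT //.
  exact: le_trans uv.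
have main u v : 0 <= u -> 0 <= v -> u <= v -> x <= c%:E * (u + v) ->
    x `^ p <= ((c * 2) `^ p)%:E * v `^ p.
  move=> u0 v0 uv xuv; rewrite -poweR_EFin -poweRM //; apply: pow_le => //.
  apply: (le_trans xuv); rewrite EFinM -muleA; apply: lee_wpmul2l.
    by rewrite lee_fin ltW.
  by rewrite mule_natl mule2n leeD2r.
have C0 : 0 <= ((c * 2) `^ p)%:E by rewrite lee_fin powR_ge0.
move=> y0 z0 xyz; have [yz|zy] := leP y z.
  apply: le_trans (main _ _ y0 z0 yz xyz) _; apply: lee_wpmul2l => //.
  by rewrite leeDr // poweR_ge0.
rewrite addeC in xyz; apply: le_trans (main _ _ z0 y0 (ltW zy) xyz) _.
by apply: lee_wpmul2l => //; rewrite leeDl // poweR_ge0.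
Qed.

Lemma mixed_pow_ge0 p m (r : m.-tuple R) (x : m.-tuple nat -> \bar R) :
  0 <= mixed_pow p r x.
Proof. by case: m r x => [|m] r x; apply: poweR_ge0. Qed.

(** Quasi-triangle inequality, by induction on the number of nested sums: the inner constant is
    pulled out of the series, and [poweR_leD] treats the outer exponent. The constant is uniform in
    [x], [y], [z]. *)
Lemma mixed_pow_leD m (r : m.-tuple R) p c : (0 < c)%R -> (0 < p)%R ->
  (forall j, 0 < tnth r j)%R ->
  exists2 C : R, (0 < C)%R & forall x y z : m.-tuple nat -> \bar R,
    (forall i, 0 <= x i) -> (forall i, 0 <= y i) -> (forall i, 0 <= z i) ->
    (forall i, x i <= c%:E * (y i + z i)) ->
    mixed_pow p r x <= C%:E * (mixed_pow p r y + mixed_pow p r z).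
Proof.
move=> c0; elim: m r p => [|m IH] r p p0 r0.
  exists ((c * 2) `^ p)%R; first by rewrite powR_gt0 // mulr_gt0.
  by move=> x y z x0 y0 z0 xyz /=; apply: poweR_leD => //; apply: ltW.
have h0 : (0 < thead r)%R by exact: r0.
have [|C C0 HC] := IH (behead_tuple r) (thead r) h0.
  by move=> j; rewrite tnth_behead.
exists ((C * 2) `^ (p / thead r))%R; first by rewrite powR_gt0 // mulr_gt0.
move=> x y z x0 y0 z0 xyz /=; apply: poweR_leD => //.
- by rewrite divr_ge0 // ltW.
- by apply: nneseries_ge0 => *; apply: mixed_pow_ge0.
- by apply: nneseries_ge0 => *; apply: mixed_pow_ge0.
- by apply: nneseries_ge0 => *; apply: mixed_pow_ge0.
rewrite -nneseriesD; try by move=> *; apply: mixed_pow_ge0.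
rewrite -nneseriesZl; last by move=> *; rewrite adde_ge0 // mixed_pow_ge0.
apply: lee_nneseries => [i _ _|i _]; first exact: mixed_pow_ge0.
exact: HC.
Qed.

Lemma mixed_pow0 m (r : m.-tuple R) p : (0 < p)%R -> (forall j, 0 < tnth r j)%R ->
  mixed_pow p r (fun=> 0) = 0.
Proof.
elim: m r p => [|m IH] r p p0 r0 /=; first by rewrite powR0 ?gt_eqF.
have h0 : (0 < thead r)%R by exact: r0.
rewrite eseries0 => [|i _ _]; last by apply: IH => // j; rewrite tnth_behead.
by rewrite poweR0r // gt_eqF // divr_gt0.
Qed.

End MixedPow.

(** * Stability of the summing classes *)

Section Summing.
Variables (R : realType) (k : scalars).
Local Notation K := (scalar_field R k).

(** The zero functional is in the dual ball, so the supremum is not the one of the empty set, which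
    is [-oo]. *)
Lemma weak_norm_ge0 (E : normedModType K) (s : R) N (x : nat -> E) :
  (0 <= weak_norm s N x)%E.
Proof.
apply: le_trans (ereal_sup_ubound _); last first.
  exists (\0 : {linear E -> K}); last by [].
  split; first exact: cst_continuous.
  apply: ge_ereal_sup => _ [v _ <-] /=.
  by rewrite rnorm0 lee_fin.
by rewrite lee_fin powR_ge0.
Qed.

Variables (m : nat) (E : 'I_m -> completeNormedModType K).
Variables (F : lmodType K) (normF : F -> R).
Hypotheses (normF0 : normF 0 = 0) (normF_ge0 : forall v, 0 <= normF v).
Implicit Types (S T : (forall j, E j) -> F).

(** A pointwise estimate of norms is all that is used of [S], so that linear combinations and
    compositions are both covered. *)
Lemma summing_bound_leD (Lambda : set (m.-tuple nat)) (r s : m.-tuple R) S T T' c :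
  0 < c -> (forall j, 0 < tnth r j) ->
  (forall x, normF (S x) <= c * (normF (T x) + normF (T' x))) ->
  summing_bound normF Lambda r s T -> summing_bound normF Lambda r s T' ->
  summing_bound normF Lambda r s S.
Proof.
move=> c0 r0 STT' [C C0 CT] [C' C'0 CT'].
have [D D0 HD] := mixed_pow_leD c0 ltr01 r0.
exists (D * (C + C')); first by rewrite mulr_gt0 // addr_gt0.
move=> N x N0 x0.
have w0 : (0 <= \prod_(j < m) weak_norm (tnth s j) N (x j))%E.
  by apply: prode_ge0 => j _; apply: weak_norm_ge0.
rewrite EFinM -muleA EFinD ge0_muleDl; try by rewrite lee_fin ltW.
have D0' : (0 <= D%:E)%E by rewrite lee_fin ltW.
apply: le_trans (lee_wpmul2l D0' (leeD (CT N x N0 x0) (CT' N x N0 x0))).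
apply: HD => [i|i|i|i]; rewrite ?lee_fin ?normF_ge0 //.
rewrite /patch; case: ifP => _ //.
by rewrite normF0 addr0 mulr0.
Qed.

Lemma summing_subspace (Lambda : set (m.-tuple nat)) (r s : m.-tuple R) :
  (forall j, 0 < tnth r j) ->
  (forall a : K, exists2 c : R, 0 < c &
    forall u v, normF (a *: u + v) <= c * (normF u + normF v)) ->
  subspace (summing E normF Lambda r s).
Proof.
move=> r0 quasi; apply/subspaceP; split.
  split=> [x j a u v /=|]; first by rewrite scaler0 addr0.
  exists 1 => // N x N0 x0; rewrite /mixed_norm.
  rewrite (_ : (fun i => _) = fun=> 0%E); last first.
    by apply/funext => i; rewrite /patch; case: ifP; rewrite normF0.
  rewrite mixed_pow0 // mule_ge0 // prode_ge0 // => j _.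
  exact: weak_norm_ge0.
move=> a T T' [Tlin Tbd] [T'lin T'bd]; have [c c0 quasi_a] := quasi a.
split; last by apply: (summing_bound_leD c0 r0 _ Tbd T'bd) => x; apply: quasi_a.
move=> x j b u v; rewrite /= -![(_ + _) (dfwith _ _ _)]/(_ *: _ + _) Tlin T'lin.
by rewrite !scalerDr addrACA !scalerA mulrC.
Qed.

Lemma summing_comp (Lambda : set (m.-tuple nat)) (r s : m.-tuple R)
    (u : {linear F -> F}) T :
  (forall j, 0 < tnth r j) -> (forall v, normF (u v) <= normF v) ->
  summing E normF Lambda r s T -> summing E normF Lambda r s (u \o T).
Proof.
move=> r0 ule [Tlin Tbd]; split.
  by move=> x j a v w /=; rewrite Tlin linearP.
(* [T] plays both roles on the right: the norm of [u (T x)] is at most that of [T x], hence at most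
   twice it. *)
apply: (summing_bound_leD ltr01 r0 _ Tbd Tbd) => x.
by rewrite mul1r (le_trans (ule _)) // lerDl.
Qed.

End Summing.

(** * Quasi-norm of the sequence spaces and transport along partial injections *)

Section Ell.
Variables (R : realType) (k : scalars) (I : choiceType).
Variables (q : \bar R) (q0 : (0 < q)%E).
Local Notation K := (scalar_field R k).
Local Notation ell := (@ell R k I q q0).
Local Notation norm := (@ell_norm R k I q q0).
Implicit Types (f g : ell) (phi : I -> option I).

Lemma ell_norm_fin (r : R) (r0 : (0 < r%:E)%E) (f : @Defs.ell R k I _ r0) :
  ((ell_norm I r0 f)%:E =
   (\esum_(i in [set: I]) (rnorm (f i) `^ r)%:E) `^ r^-1)%E.
Proof.
rewrite /ell_norm -poweR_EFin fineK // ge0_fin_numE; first exact: set_mem (ell_valP f).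
by apply: esum_ge0 => i _; rewrite lee_fin powR_ge0.
Qed.

Lemma ell_sup_ub (f : I -> K) i : in_ell +oo%E f ->
  rnorm (f i) <= sup [set rnorm (f j) | j in [set: I]].
Proof.
move=> [M fM]; apply: ub_le_sup; last by exists i.
by exists M => _ [j _ <-].
Qed.

Lemma ell_sup_le (f : I -> K) (M : R) : 0 <= M -> (forall i, rnorm (f i) <= M) ->
  sup [set rnorm (f j) | j in [set: I]] <= M.
Proof.
move=> M0 fM; have [[i _]|I0] := pselect ([set: I] !=set0).
  by apply: ge_sup => [|_ [j _ <-]//]; exists (rnorm (f i)), i.
rewrite (_ : [set _ | _ in _] = set0) ?sup0 //.
by apply/seteqP; split=> // y [i _ _]; apply: I0; exists i.
Qed.

(** For an empty or unbounded set of values, [sup] is 0 by default. *)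
Lemma ell_sup_ge0 (f : I -> K) : 0 <= sup [set rnorm (f j) | j in [set: I]].
Proof.
have [[[_ [i _ _]] ub]|/sup_out ->//] :=
  pselect (has_sup [set rnorm (f j) | j in [set: I]]).
by apply: le_trans (rnorm_ge0 (f i)) (ub_le_sup ub _); exists i.
Qed.

Lemma ell_norm_ge0 f : 0 <= norm f.
Proof.
rewrite /ell_norm; case: q q0 f => [r| |] // r0 f; first exact: powR_ge0.
exact: ell_sup_ge0.
Qed.

Lemma ell_norm0 : norm 0 = 0.
Proof.
rewrite /ell_norm; case: q q0 => [r| |] // r0.
  rewrite esum1 ?powR0 //= => [|i _].
    by rewrite gt_eqF // invr_gt0.
  by rewrite rnorm0 powR0 // gt_eqF.
apply/eqP; rewrite eq_le ell_sup_ge0 andbT; apply: ell_sup_le => // i.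
by rewrite rnorm0.
Qed.

(* A partial map [phi] is viewed as an [option]-valued function, and functions
   are transported along it with the value [0] where [phi] is undefined. *)
Definition pull_fun phi (f : I -> K) : I -> K :=
  fun i => if phi i is Some j then f j else 0.

Definition pinjective phi :=
  forall i i' j, phi i = Some j -> phi i' = Some j -> i = i'.

(** Injectivity of [phi] on its domain turns the left side into the sum of [a] over the image of
    [phi], a part of [I]. *)
Lemma esum_pull (a : I -> \bar R) phi : (forall i, 0 <= a i)%E -> pinjective phi ->
  (\esum_(i in [set: I]) (if phi i is Some j then a j else 0) <=
   \esum_(i in [set: I]) a i)%E.
Proof.
move=> a0 phi_inj; pose D := [set i | phi i != None]; pose g i := odflt i (phi i).
rewrite (_ : esum _ _ = \esum_(i in D) a (g i))%E; last first.
  rewrite [RHS]esum_mkcond; apply: eq_esum => i _; rewrite /g.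
  case: ifPn => [/set_mem|/negP iD] /=; rewrite /D /=; first by case: (phi i).
  by case E: (phi i) => //; case: iD; apply/mem_set; rewrite /D /= E.
rewrite -(esum_image D g a); last first.
  move=> i i' /set_mem; rewrite /D /g /=; case Ei: (phi i) => [j|] // _.
  move=> /set_mem /=; case Ei': (phi i') => [j'|] // _ /= jj'.
  by apply: (phi_inj i i' j) => //; rewrite Ei' jj'.
rewrite (esum_mkcond (g @` D)); apply: le_esum => i _.
by case: ifP.
Qed.

Lemma ell_norm_le_pull phi f g : pinjective phi ->
  (g : I -> K) = pull_fun phi f -> norm g <= norm f.
Proof.
move=> phi_inj; case: q q0 f g => [r r0 f g gE|r0 f g gE|]; last by [].
  (* The norms are abstracted: unifying [ell_norm f] with [ell_norm g] diverges. *)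
  have le_fin (Nf Ng : R) :
      Nf%:E = ((\esum_(i in [set: I]) (rnorm (f i) `^ r)%:E) `^ r^-1)%E ->
      Ng%:E = ((\esum_(i in [set: I]) (rnorm (g i) `^ r)%:E) `^ r^-1)%E ->
      Ng <= Nf.
    move=> NfE NgE; rewrite -lee_fin NfE NgE.
    have r_gt0 : 0 < r by rewrite -lte_fin.
    apply: gt0_ler_poweR; rewrite ?in_itv /= ?leey ?andbT ?invr_ge0 ?(ltW r_gt0) //.
    - by apply: esum_ge0 => i _; rewrite lee_fin powR_ge0.
    - by apply: esum_ge0 => i _; rewrite lee_fin powR_ge0.
    apply: le_trans (esum_pull _ phi_inj); last by move=> i; rewrite lee_fin powR_ge0.
    apply: le_esum => i _; rewrite gE /pull_fun; case: (phi i) => [j|]; first exact: lexx.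
    by rewrite rnorm0 powR0 // gt_eqF.
  exact: le_fin (ell_norm_fin f) (ell_norm_fin g).
apply: ell_sup_le => [|i]; first exact: ell_sup_ge0.
rewrite gE /pull_fun; case: (phi i) => [j|]; last by rewrite rnorm0 ell_sup_ge0.
exact: ell_sup_ub (set_mem (ell_valP f)).
Qed.

Lemma in_ell_pull phi f : pinjective phi -> pull_fun phi f \in in_ell q.
Proof.
move=> phi_inj; apply/mem_set; case: q q0 f => [r| |] // r0 f.
  apply: le_lt_trans (set_mem (ell_valP f)) => /=.
  apply: le_trans (esum_pull _ phi_inj); last by move=> i; rewrite lee_fin powR_ge0.
  apply: le_esum => i _; rewrite /pull_fun; case: (phi i) => [j|]; first exact: lexx.
  by rewrite rnorm0 powR0 // gt_eqF.
have [M fM] := set_mem (ell_valP f); exists `|M| => i; rewrite /pull_fun.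
case: (phi i) => [j|]; last by rewrite rnorm0.
by rewrite (le_trans (fM j)) // ler_norm.
Qed.

Definition pull phi (h : pinjective phi) f : ell := Ell q0 (in_ell_pull f h).

Lemma pull_linear phi (h : pinjective phi) : linear (pull h).
Proof.
move=> a f g; apply: val_inj; apply/funext => i /=.
rewrite /pull_fun -[RHS]/(a * pull h f i + pull h g i) /= /pull_fun.
by case: (phi i) => [j|]; rewrite ?mulr0 ?addr0.
Qed.

HB.instance Definition _ phi (h : pinjective phi) :=
  GRing.isLinear.Build K ell ell *:%R (pull h) (pull_linear h).

Lemma le_esumZl (c : R) (a : I -> \bar R) : 0 <= c -> (forall i, 0 <= a i)%E ->
  (\esum_(i in [set: I]) (c%:E * a i) <= c%:E * \esum_(i in [set: I]) a i)%E.
Proof.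
move=> c0 a0; apply: ge_ereal_sup => _ [X XF <-] /=.
rewrite -ge0_mule_fsumr //; apply: lee_wpmul2l; first by rewrite lee_fin.
by apply: ereal_sup_ubound; exists X.
Qed.

Lemma ell_norm_quasi (a : K) : exists2 c : R, 0 < c &
  forall f g, norm (a *: f + g) <= c * (norm f + norm g).
Proof.
have a1 : 0 < rnorm a + 1 by rewrite ltr_wpDl // rnorm_ge0.
have combE (f g : I -> K) i :
    rnorm (a * f i + g i) <= (rnorm a + 1) * (rnorm (f i) + rnorm (g i)).
  apply: le_trans (ler_rnormD _ _) _; rewrite rnormM mulrDr lerD //.
    by rewrite ler_wpM2r ?rnorm_ge0 // lerDl.
  by rewrite ler_peMl ?rnorm_ge0 // lerDr rnorm_ge0.
case: q q0 => [r r0|r0|]; last by [].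
  have r_gt0 : 0 < r by rewrite -lte_fin.
  (* [poweR_leD] is used twice: with exponent [r] at each coordinate, which gives [c], and with
     exponent [r^-1] on the sums, which gives the final constant. *)
  pose c := ((rnorm a + 1) * 2) `^ r; have c0 : 0 < c by rewrite powR_gt0 // mulr_gt0.
  exists ((c * 2) `^ r^-1); first by rewrite powR_gt0 // mulr_gt0.
  have s0 (f : I -> K) : (0 <= \esum_(i in [set: I]) (rnorm (f i) `^ r)%:E)%E.
    by apply: esum_ge0 => i _; rewrite lee_fin powR_ge0.
  have le_fin (f g : I -> K) (Nf Ng N : R) :
      Nf%:E = ((\esum_(i in [set: I]) (rnorm (f i) `^ r)%:E) `^ r^-1)%E ->
      Ng%:E = ((\esum_(i in [set: I]) (rnorm (g i) `^ r)%:E) `^ r^-1)%E ->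
      N%:E = ((\esum_(i in [set: I]) (rnorm (a * f i + g i) `^ r)%:E) `^ r^-1)%E ->
      N <= (c * 2) `^ r^-1 * (Nf + Ng).
    move=> NfE NgE NE; rewrite -lee_fin EFinM EFinD NfE NgE NE.
    apply: poweR_leD => //; first by rewrite invr_ge0 ltW.
    rewrite -esumD; try by move=> *; rewrite lee_fin powR_ge0.
    apply: le_trans (le_esumZl (ltW c0) _); last first.
      by move=> i; rewrite adde_ge0 // lee_fin powR_ge0.
    apply: le_esum => i _; rewrite -!poweR_EFin; apply: poweR_leD => //.
    - exact: ltW.
    - by rewrite lee_fin rnorm_ge0.
    - by rewrite lee_fin rnorm_ge0.
    - by rewrite lee_fin rnorm_ge0.
    - by rewrite -EFinD -EFinM lee_fin; apply: combE.
  by move=> f g; apply: (le_fin f g); apply: ell_norm_fin.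
exists (rnorm a + 1) => // f g; apply: ell_sup_le => [|i].
  by apply: mulr_ge0; [exact: ltW|apply: addr_ge0; exact: ell_sup_ge0].
apply: le_trans (combE f g i) _; apply: ler_wpM2l; [exact: ltW|apply: lerD].
  exact: ell_sup_ub (set_mem (ell_valP f)).
exact: ell_sup_ub (set_mem (ell_valP g)).
Qed.

End Ell.

Lemma infinite_pairing T : infinite_set [set: T] ->
  exists h : T * T -> T, injective h.
Proof.
move=> /card_square /card_le_relP[S [Stot Sinj]].
have /choice[h hS] p : exists k, S p k by have [//|k _ Sk] := Stot p; exists k.
by exists h => p p' hp; apply: (Sinj p p' (h p)) => //; rewrite hp.
Qed.

(** * Disjoint copies of an operator *)

Section Copies.
Variables (R : realType) (k : scalars) (I : choiceType).
Variables (q : \bar R) (q0 : (0 < q)%E).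
Local Notation K := (scalar_field R k).
Variables (h : I * I -> I) (h_inj : injective h).

(** The set of all [h (a, i)] is the copy of [I] with label [a]. Pulling along [fiber a] restricts a
    function to this copy and reads it on [I]. *)
Definition fiber a (i : I) : option I := Some (h (a, i)).

(** Partial inverse of [fiber a]: pulling along it places a function on the copy labelled [a] and
    extends it by 0. *)
Definition unfiber a (i : I) : option I :=
  if pselect (exists j, h (a, j) = i) is left H then Some (sval (cid H)) else None.

Lemma fiber_pinjective a : pinjective (fiber a).
Proof. by move=> i i' j [<-] [/h_inj[]]. Qed.

Lemma unfiber_pinjective a : pinjective (unfiber a).
Proof.
have unfiberK i j : unfiber a i = Some j -> h (a, j) = i.
  by rewrite /unfiber; case: pselect => // H [<-]; case: cid.
by move=> i i' j /unfiberK <- /unfiberK <-.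
Qed.

Arguments fiber_pinjective : clear implicits.
Arguments unfiber_pinjective : clear implicits.

Lemma unfiber_fiber a b i : unfiber a (h (b, i)) = if a == b then Some i else None.
Proof.
rewrite /unfiber; case: pselect => [H|nH].
  by case: cid => j /= /h_inj[-> ->]; rewrite eqxx.
by case: eqP => // ab; case: nH; exists i; rewrite ab.
Qed.

Lemma pull_fiber_unfiber a b (f : @ell R k I q q0) :
  pull (fiber_pinjective b) (pull (unfiber_pinjective a) f) = if a == b then f else 0.
Proof.
apply: val_inj; apply/funext => i /=; rewrite /pull_fun /= unfiber_fiber.
by case: eqP.
Qed.

Variables (m : nat) (E : 'I_m -> completeNormedModType K).

Lemma summing_ell_subspace (Lambda : set (m.-tuple nat)) (r s : m.-tuple R) :
  (forall j, 0 < tnth r j) -> subspace (summing E (ell_norm I q0) Lambda r s).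
Proof.
move=> r0; apply: (summing_subspace _ (@ell_norm0 R k I q q0)
  (@ell_norm_ge0 R k I q q0) _ _ r0); exact: ell_norm_quasi.
Qed.

Lemma summing_pull (Lambda : set (m.-tuple nat)) (r s : m.-tuple R)
    phi (phi_inj : pinjective phi) T :
  (forall j, 0 < tnth r j) -> summing E (ell_norm I q0) Lambda r s T ->
  summing E (ell_norm I q0) Lambda r s (pull phi_inj \o T).
Proof.
move=> r0; apply: (summing_comp (@ell_norm0 R k I q q0) (@ell_norm_ge0 R k I q q0) r0).
by move=> f; exact: (ell_norm_le_pull phi_inj).
Qed.

Definition copy a (T : (forall j, E j) -> ell k I q0) : (forall j, E j) -> ell k I q0 :=
  pull (unfiber_pinjective a) \o T.

Lemma copy_indep (Gamma : set (m.-tuple nat)) (t u : m.-tuple R) T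
    (t0 : forall j, 0 < tnth t j)
    (U := summing E (ell_norm I q0) Gamma t u) :
  ~ U T -> forall (Z : {fset I}) (c : I -> K),
  U (\sum_(a <- Z) c a *: copy a T) -> {in Z, forall a, c a = 0}.
Proof.
move=> UT Z c Usum b bZ; apply/eqP/negPn/negP => cb0; apply: UT.
rewrite -[T](scalerK cb0); apply: subspaceZ; first exact: summing_ell_subspace.
(* Restriction to the copy labelled [b] kills all other terms and does not increase norms, so it
   would put [c b *: T], and hence [T], into [U]. *)
have -> : c b *: T = pull (fiber_pinjective b) \o \sum_(a <- Z) c a *: copy a T.
  apply/funext => x /=; rewrite fct_sumE linear_sum (big_fsetD1 b) //=.
  rewrite big_seq big1 ?addr0 => [|a].
    by rewrite -[(c b *: copy b T) x]/(c b *: copy b T x) linearZ /=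
      pull_fiber_unfiber eqxx.
  rewrite !inE => /andP[/negbTE ab _].
  by rewrite -[(c a *: copy a T) x]/(c a *: copy a T x) linearZ /=
    pull_fiber_unfiber ab scaler0.
exact: summing_pull.
Qed.

End Copies.

Theorem proposition5p1 (R : realType) (k : scalars) (m : nat) (m0 : (0 < m)%N)
  (q : \bar R) (q0 : (0 < q)%E)
  (I : choiceType) (I0 : [set: I] !=set0)
  (E : 'I_m -> completeNormedModType (scalar_field R k))
  (Einf : forall j, infinite_dim [set: E j])
  (Elt : forall j, dim_lt [set: E j] [set: I])
  (r s t u : m.-tuple R)
  (r1 : forall j, 1 <= tnth r j) (s1 : forall j, 1 <= tnth s j)
  (t1 : forall j, 1 <= tnth t j) (u1 : forall j, 1 <= tnth u j)
  (Lambda Gamma : set (m.-tuple nat))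
  (Lambda0 : Lambda !=set0) (LG : Lambda `<=` Gamma) :
  let V := summing E (ell_norm I q0) Lambda r s in
  let A := V `\` summing E (ell_norm I q0) Gamma t u in
  A = set0 \/
  forall (T : Type) (alpha : set T),
    card_lt alpha [set: I] -> lineable2 V A alpha [set: I].
Proof.
move=> V A; have [->|/set0P[T [VT UT]]] := eqVneq A set0; [by left|right].
(* As [m] is positive there is a first space; its Hamel basis is infinite and injects into [I]. *)
have Iinf : infinite_set [set: I].
  move=> Ifin; have [B Bbasis [BI _]] := Elt (Ordinal m0).
  by apply: (Einf (Ordinal m0)); exists B; [exact: Bbasis|exact: card_le_finite BI Ifin].
have r0 j : 0 < tnth r j by apply: lt_le_trans (r1 j).
have t0 j : 0 < tnth t j by apply: lt_le_trans (t1 j).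
have [h h_inj] := infinite_pairing Iinf.
(* The copies of [T], labelled by [I], are pairwise distinct and form the independent set required
   by [lineable2_setD]. *)
have [e_inj e_indep eU] :=
  range_indep_mod (summing_ell_subspace I q0 E Gamma u t0) (copy_indep h_inj t0 UT).
have VE : range (fun a => copy h a T) `<=` V.
  by move=> _ [a _ <-]; apply: summing_pull.
move=> X alpha; apply: (lineable2_setD _ _ VE e_indep eU Iinf).
- exact: summing_ell_subspace.
- exact: summing_ell_subspace.
- exact: inj_card_eq (in2W e_inj).
Qed.
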